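(* Suppose the budget and utility parameters of users are drawn i.i.d. from a distribution $\mathcal{D}$ such that (i) for each good $j$, $\mathbb{P}_{\mathcal{D}}(u_j>0)>0$, and (ii) the support satisfies $\mathbf{u}\in[\underline{\mathbf{u}},\bar{\mathbf{u}}]$ and $w\in[\underline w,\bar w]$ with $\underline{u},\underline w>0$. Let $\boldsymbol{\pi}$ be the revealed preference pricing policy described below, with allocations $\mathbf{x}_1,\dots,\mathbf{x}_n$. Then for step size $\gamma=\gamma_t=\bar D/\sqrt{n}$ for all $t\in[n]$, for some constant $\bar D>0$, the expected regret satisfies $R_n(\boldsymbol{\pi})\le O(\sqrt n)$ and the expected constraint violation satisfies $V_n(\boldsymbol{\pi})\le O(\sqrt n)$.
   Context: Online Fisher market: $m$ divisible goods, good $j$ with capacity $c_j=nd_j$, $\mathbf{d}>\mathbf{0}$; $n$ users arrive sequentially, user $t$ with budget $w_t$ and utility vector $\mathbf{u}_t$, $(w_t,\mathbf{u}_t)$ i.i.d. from $\mathcal{D}$. Given price $\mathbf{p}^t$, user $t$ consumes an optimal solution $\mathbf{x}_t$ of $\max\mathbf{u}_t^\top\mathbf{x}$ s.t. $(\mathbf{p}^t)^\top\mathbf{x}\le w_t$, $\mathbf{x}\ge\mathbf{0}$. Revealed preference algorithm: initialize $\mathbf{p}^1>\mathbf{0}$; for $t=1,\dots,n$, user $t$ consumes $\mathbf{x}_t$ at price $\mathbf{p}^t$, then $\mathbf{p}^{t+1}=\mathbf{p}^t-\gamma_t(\mathbf{d}-\mathbf{x}_t)$ (no projection). Offline optimum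 $U_n^*=\max\{\sum_t w_t\log(\sum_j u_{tj}x_{tj}):\sum_t x_{tj}\le c_j\ \forall j,\ x\ge0\}$; $U_n(\boldsymbol{\pi})=\sum_t w_t\log(\mathbf{u}_t^\top\mathbf{x}_t)$; $R_n(\boldsymbol{\pi})=\mathbb{E}[U_n^*-U_n(\boldsymbol{\pi})]$; $V_n(\boldsymbol{\pi})=\mathbb{E}[\|(\sum_t\mathbf{x}_t-\mathbf{c})_+\|_2]$. Asymptotics are as $n\to\infty$ with $m,\mathbf{d},\mathcal{D},\mathbf{p}^1,\bar D$ fixed. *)

(* Defs.v *)
From HB Require Import structures.
From mathcomp Require Import all_boot all_order all_algebra.
From mathcomp Require Import all_classical all_reals all_analysis.
Set Implicit Arguments. Unset Strict Implicit. Unset Printing Implicit Defensive.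
Import Order.TTheory GRing.Theory Num.Theory.
Import numFieldNormedType.Exports.
Local Open Scope classical_set_scope.
Local Open Scope ring_scope.

Section OnlineFisher.
Context {R : realType} {m : nat}.

(* A vector of R^m is an m-tuple (measurable with the product sigma-algebra). *)
Definition dotp (a b : m.-tuple R) : R := \sum_(j < m) tnth a j * tnth b j.

Definition budget_feasible (p : m.-tuple R) (w : R) (x : m.-tuple R) : Prop :=
  (forall j, 0 <= tnth x j) /\ dotp p x <= w.

Definition is_user_opt (p : m.-tuple R) (w : R) (u : m.-tuple R)
    (x : m.-tuple R) : Prop :=
  budget_feasible p w x /\
  forall y, budget_feasible p w y -> dotp u y <= dotp u x.

Definition user := (R * m.-tuple R)%type.

(* Revealed-preference algorithm (0-based index: user t+1 of the paper is t).
   [choose t p s] is the bundle consumed by user t at price p with parameters s. *)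
Fixpoint rp_price (choose : nat -> m.-tuple R -> user -> m.-tuple R)
    (gamma : R) (d p1 : m.-tuple R) (xi : nat -> user) (t : nat)
    : m.-tuple R :=
  match t with
  | 0 => p1
  | t'.+1 =>
      let p := rp_price choose gamma d p1 xi t' in
      let x := choose t' p (xi t') in
      [tuple tnth p j - gamma * (tnth d j - tnth x j) | j < m]
  end.

Definition rp_alloc choose gamma d p1 (xi : nat -> user) (t : nat)
    : m.-tuple R :=
  choose t (rp_price choose gamma d p1 xi t) (xi t).

Definition online_utility choose gamma d p1 (xi : nat -> user) (n : nat) : R :=
  \sum_(t < n) (xi t).1 * ln (dotp (xi t).2 (rp_alloc choose gamma d p1 xi t)).

(* Offline optimum U_n^* of the Eisenberg-Gale program with capacities c = n d;
   log(0) = -infinity, so only allocations giving every user positive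
   utility can attain the supremum. *)
Definition offline_opt (d : m.-tuple R) (xi : nat -> user) (n : nat) : \bar R :=
  ereal_sup
    ((fun X : 'I_n -> 'I_m -> R =>
        (\sum_(t < n) (xi t).1 *
           ln (\sum_(j < m) tnth (xi t).2 j * X t j))%:E) @`
     [set X | (forall (t : 'I_n) (j : 'I_m), 0 <= X t j) /\
              (forall j, \sum_(t < n) X t j <= n%:R * tnth d j) /\
              (forall t : 'I_n, 0 < \sum_(j < m) tnth (xi t).2 j * X t j)]).

Definition violation choose gamma d p1 (xi : nat -> user) (n : nat) : R :=
  Num.sqrt (\sum_(j < m)
    (Num.max 0 (\sum_(t < n) tnth (rp_alloc choose gamma d p1 xi t) j
                - n%:R * tnth d j)) ^+ 2).

End OnlineFisher.

Definition iid_with_law {R : realType} {dO} {Omega : measurableType dO}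
    (P : probability Omega R) {dS} {S : measurableType dS}
    (D : probability S R) (xi : nat -> Omega -> S) : Prop :=
  (forall t, measurable_fun setT (xi t)) /\
  (forall t (A : set S), measurable A -> P (xi t @^-1` A) = D A) /\
  (forall (s : seq nat) (A : nat -> set S), uniq s ->
     (forall t, measurable (A t)) ->
     P (\big[setI/setT]_(t <- s) (xi t @^-1` A t)) =
     \big[*%E/1%E]_(t <- s) P (xi t @^-1` A t)).

(* Main.v *)
(** The revealed preference update is stochastic subgradient descent on the
dual [f p = p . d + E [v p s]] of the fluid problem, where [v p s] is the
optimal utility [w log (u . x)] of user [s] at price [p].

- For a small step size all prices stay in a fixed box of positive prices.
  Above, because a user never buys more than [w / p_j] of good [j]; below,
  because [sum_j 1 / p_j] is a Lyapunov function of the update.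
- The violation is then immediate, since [sum_t x_t - n d] telescopes to
  [(p^(n+1) - p^1) / gamma].
- By weak duality, for every fixed price [p] the regret is at most
  [sum_t (f_t p - f_t (p^t)) + sum_t (p^t . d - w_t)]. As users exhaust
  their budget, the last sum is [sum_t p^t . (d - x_t)], which is [O (sqrt n)]
  by telescoping [|p^t|^2]. The price [p^t] is independent of user [t], so
  the first sum has expectation at most [sqrt n] when [p] minimizes [f] over
  the box up to [1 / sqrt n]. *)

Require Import Defs.
From HB Require Import structures.
From mathcomp Require Import all_boot all_order all_algebra.
From mathcomp Require Import all_classical all_reals all_analysis.
From mathcomp Require Import measurable_realfun ring lra.
Import Order.TTheory GRing.Theory Num.Theory.
Import numFieldNormedType.Exports.
Local Open Scope classical_set_scope.
Local Open Scope ring_scope.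

(** * Optimal bundles of a single user *)

Section UserOptimum.
Context {R : realType} {m : nat}.
Implicit Types (p u x y z : m.-tuple R) (w : R).

Lemma dotp_single z k (a : R) :
  dotp z [tuple if j == k then a else 0 | j < m] = tnth z k * a.
Proof.
rewrite /dotp (bigD1 k)//= tnth_mktuple eqxx big1 ?addr0// => i ik.
by rewrite tnth_mktuple (negbTE ik) mulr0.
Qed.

(** Spending the whole budget on a good with the largest ratio [u_j / p_j] is optimal, as this ratio
    bounds the utility per unit of money. *)
Lemma user_opt_exists (j0 : 'I_m) p w u :
  (forall j, 0 < tnth p j) -> 0 <= w -> (forall j, 0 < tnth u j) ->
  exists x, is_user_opt p w u x.
Proof.
move=> p0 w0 u0.
pose k := [arg max_(k > j0) (tnth u k / tnth p k)]%O.
have kmax j : tnth u j / tnth p j <= tnth u k / tnth p k.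
  by rewrite /k; case: arg_maxP => // i _ /(_ j isT).
exists [tuple if j == k then w / tnth p k else 0 | j < m]; split.
  split; last by rewrite dotp_single mulrCA divff ?mulr1// gt_eqF.
  by move=> j; rewrite tnth_mktuple; case: ifP => // _; rewrite divr_ge0// ltW.
move=> y [y0 yw]; rewrite dotp_single mulrCA mulrC.
apply: (le_trans (y := tnth u k / tnth p k * dotp p y)); last first.
  by apply: ler_wpM2l => //; rewrite divr_ge0// ltW.
rewrite /dotp mulr_sumr ler_sum// => j _; rewrite mulrA ler_wpM2r//.
by rewrite -ler_pdivrMr.
Qed.

(** Compare [x] with spending all of [w] on good [j]. Read as [u_j <= l p_j] with [l = (u . x) / w],
    this is dual feasibility for the linear program of the user. *)
Lemma user_opt_price p w u x j : (forall j, 0 < tnth p j) -> 0 <= w ->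
  is_user_opt p w u x -> w * tnth u j <= dotp u x * tnth p j.
Proof.
move=> p0 w0 [_ /(_ [tuple if i == j then w / tnth p j else 0 | i < m])].
rewrite dotp_single => opt; rewrite -ler_pdivrMr// mulrAC mulrC; apply: opt.
split; last by rewrite dotp_single mulrCA divff ?mulr1// gt_eqF.
by move=> i; rewrite tnth_mktuple; case: ifP => // _; rewrite divr_ge0// ltW.
Qed.

Lemma user_opt_dual p w u x y : (forall j, 0 < tnth p j) -> 0 <= w ->
  is_user_opt p w u x -> (forall j, 0 <= tnth y j) ->
  w * dotp u y <= dotp u x * dotp p y.
Proof.
move=> p0 w0 xopt y0; rewrite /dotp !mulr_sumr ler_sum// => j _.
by rewrite !mulrA ler_wpM2r//; exact: user_opt_price.
Qed.

Lemma user_opt_gt0 (j0 : 'I_m) p w u x : (forall j, 0 < tnth p j) -> 0 < w ->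
  (forall j, 0 < tnth u j) -> is_user_opt p w u x -> 0 < dotp u x.
Proof.
move=> p0 w0 u0 /(user_opt_price p w u x j0 p0 (ltW w0)) H.
by rewrite -(pmulr_lgt0 _ (p0 j0)) (lt_le_trans _ H)// mulr_gt0.
Qed.

Lemma user_opt_budget (j0 : 'I_m) p w u x : (forall j, 0 < tnth p j) -> 0 < w ->
  (forall j, 0 < tnth u j) -> is_user_opt p w u x -> dotp p x = w.
Proof.
move=> p0 w0 u0 xopt; have a0 := user_opt_gt0 j0 p w u x p0 w0 u0 xopt.
have [[x0 xw] _] := xopt; apply/eqP; rewrite eq_le xw/=.
have := user_opt_dual p w u x x p0 (ltW w0) xopt x0.
by rewrite mulrC ler_pM2l.
Qed.

(** Complementary slackness: the terms are nonnegative by [user_opt_price] and sum to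
    [(u . x) (p . x) - w (u . x)], which is 0 since the budget is spent. *)
Lemma user_opt_slack (j0 : 'I_m) p w u x k : (forall j, 0 < tnth p j) -> 0 < w ->
  (forall j, 0 < tnth u j) -> is_user_opt p w u x ->
  (dotp u x * tnth p k - w * tnth u k) * tnth x k = 0.
Proof.
move=> p0 w0 u0 xopt; have [[x0 _] _] := xopt.
have ge0 j : 0 <= (dotp u x * tnth p j - w * tnth u j) * tnth x j.
  by rewrite mulr_ge0// subr_ge0 user_opt_price// ltW.
have : \sum_j (dotp u x * tnth p j - w * tnth u j) * tnth x j = 0.
  under eq_bigr do rewrite mulrBl -!mulrA.
  rewrite sumrB -!mulr_sumr -/(dotp p x) -/(dotp u x).
  by rewrite (user_opt_budget j0 p w u x)// mulrC subrr.
move/eqP; rewrite psumr_eq0 => [|j _]//.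
by move/allP => /(_ k (mem_index_enum k))/eqP.
Qed.

(** The bundle also maximizes the Lagrangian [w ln (u . y) - p . y]: [user_opt_dual] bounds [u . y]
    by [(u . x) z] with [z = p . y / w], and [ln z <= z - 1]. *)
Lemma user_opt_ln_dual (j0 : 'I_m) p w u x y :
  (forall j, 0 < tnth p j) -> 0 < w -> (forall j, 0 < tnth u j) ->
  is_user_opt p w u x -> (forall j, 0 <= tnth y j) -> 0 < dotp u y ->
  w * ln (dotp u y) <= w * ln (dotp u x) + dotp p y - w.
Proof.
move=> p0 w0 u0 xopt y0 uy0.
have a0 := user_opt_gt0 j0 p w u x p0 w0 u0 xopt.
have dual := user_opt_dual p w u x y p0 (ltW w0) xopt y0.
have py0 : 0 < dotp p y / w.
  rewrite divr_gt0// -(pmulr_rgt0 _ a0) (lt_le_trans _ dual)//.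
  by rewrite mulr_gt0.
have : ln (dotp u y) <= ln (dotp u x) + (dotp p y / w - 1).
  apply: (@le_trans _ _ (ln (dotp u x * (dotp p y / w)))).
    rewrite ler_ln ?posrE//; last exact: mulr_gt0.
    by rewrite mulrA ler_pdivlMr// mulrC.
  rewrite lnM ?posrE// lerD2l -[X in ln X](subrK 1) [X in ln X]addrC.
  by rewrite le_ln1Dx// ltrBrDr addNr.
move=> /(ler_wpM2l (ltW w0)) /le_trans; apply.
rewrite mulrDr -addrA lerD2l mulrBr mulr1 mulrCA divff ?gt_eqF//.
by rewrite mulr1.
Qed.

End UserOptimum.

(** * One step of the price update *)

Lemma le_term_sum {R : realType} {m} (f : 'I_m -> R) j : (forall j, 0 <= f j) ->
  f j <= \sum_(i < m) f i.
Proof. by move=> f0; rewrite (bigD1 j)//= lerDl sumr_ge0. Qed.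

(** Second-order expansion of the inverse. The remainder is exactly [e^2 / (p^2 (p - e))], and
    [2 g <= p] keeps [p - e >= p / 2], so that [1 / (p - e) <= 2 B]. *)
Lemma inv_sub_le {R : realFieldType} (p e g B : R) :
  0 < p -> p^-1 <= B -> `|e| <= g -> 2 * g <= p ->
  (p - e)^-1 <= p^-1 + e * p^-1 ^+ 2 + 2 * g ^+ 2 * B ^+ 3.
Proof.
move=> p0 pB eg gp.
have g0 : 0 <= g by exact: le_trans eg.
have [e1 e2] : - g <= e /\ e <= g by apply/andP; rewrite -ler_norml.
have pe0 : p / 2 <= p - e by lra.
have pe : 0 < p - e by lra.
have -> : (p - e)^-1 = p^-1 + e * p^-1 ^+ 2 + e ^+ 2 * (p^-1 ^+ 2 * (p - e)^-1).
  by field; apply/andP; split; rewrite gt_eqF.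
rewrite lerD2l.
have q0 : 0 <= p^-1 by rewrite invr_ge0 ltW.
have -> : 2 * g ^+ 2 * B ^+ 3 = g ^+ 2 * (B ^+ 2 * (2 * B)) by ring.
apply: ler_pM => //; first exact: sqr_ge0.
- by rewrite mulr_ge0 ?sqr_ge0// invr_ge0 ltW.
- by rewrite -real_normK ?num_real// lerXn2r// nnegrE.
apply: ler_pM => //; first exact: sqr_ge0.
- by rewrite invr_ge0 ltW.
- by rewrite lerXn2r// nnegrE (le_trans q0).
apply: (@le_trans _ _ (p / 2)^-1); first by rewrite lef_pV2 ?posrE// divr_gt0.
by rewrite invfM invrK mulrC ler_pM2l.
Qed.

Section Step.
Context {R : realType} {m : nat}.
Implicit Types (p u x d : m.-tuple R).

Definition user_box (wl wh ul uh : R) : set (@user R m) :=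
  [set s | wl <= s.1 <= wh /\ forall j, ul <= tnth s.2 j <= uh].

Definition inv_sum p : R := \sum_(j < m) (tnth p j)^-1.

Lemma le_inv_sum p j : (forall j, 0 < tnth p j) -> (tnth p j)^-1 <= inv_sum p.
Proof.
move=> p0; rewrite /inv_sum (bigD1 j)//= lerDl sumr_ge0// => i _.
by rewrite invr_ge0 ltW.
Qed.

Lemma budget_alloc_le p x w B j : (forall j, 0 < tnth p j) -> inv_sum p <= B ->
  budget_feasible p w x -> tnth x j <= w * B.
Proof.
move=> p0 pB [x0 xw].
have pxw : tnth p j * tnth x j <= w.
  apply: le_trans xw; rewrite /dotp (bigD1 j)//= lerDl sumr_ge0// => i _.
  by rewrite mulr_ge0// ltW.
have px0 : 0 <= tnth p j * tnth x j by rewrite mulr_ge0// ltW.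
rewrite -[leLHS](mulKf (lt0r_neq0 (p0 j))) mulrC ler_pM//.
  by rewrite invr_ge0 ltW.
exact: le_trans (le_inv_sum _ _ p0) pB.
Qed.

Lemma excess_le d p x w B j : (forall j, 0 < tnth d j) ->
  (forall j, 0 < tnth p j) -> inv_sum p <= B -> budget_feasible p w x ->
  `|tnth d j - tnth x j| <= \sum_(j < m) tnth d j + w * B.
Proof.
move=> d0 p0 pB bx; have xle := budget_alloc_le p x w B j p0 pB bx.
have [x0 _] := bx; have := le_term_sum (tnth d) j (fun i => ltW (d0 i)).
have := d0 j; have := x0 j.
by rewrite ler_norml => ? ? ?; apply/andP; split; lra.
Qed.

Context {wl wh ul uh : R} (wl0 : 0 < wl) (ul0 : 0 < ul).
Context {d : m.-tuple R} (d0 : forall j, 0 < tnth d j).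

(* With [l] the utility per unit of money at [p], goods satisfy [u <= l p],
   with equality for those actually bought. Hence the demand contributes at
   least [w (l / uh)^3] to the decrease of [inv_sum] while the capacities
   contribute at most [(sum d) (l / ul)^2] to its increase: the former wins
   for [l] large, and [l] bounded keeps the prices away from 0. *)
Lemma inv_sum_step (j0 : 'I_m) p (s : user) x (g B L G : R) :
  (forall j, 0 < tnth p j) -> inv_sum p <= B ->
  user_box wl wh ul uh s -> is_user_opt p s.1 s.2 x ->
  G = \sum_(j < m) tnth d j + wh * B ->
  0 <= g -> g * (2 * G * B) <= 1 -> g * (2 * m%:R * G ^+ 2 * B ^+ 3) <= 1 ->
  1 <= L -> (\sum_(j < m) tnth d j) / ul ^+ 2 + 1 <= wl * L / uh ^+ 3 ->
  2 * m%:R * L / ul <= B ->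
  let p' := [tuple tnth p j - g * (tnth d j - tnth x j) | j < m] in
  (forall j, 0 < tnth p' j) /\ inv_sum p' <= B.
Proof.
move=> p0 pB [sw su] xopt GE g0 gG1 gG2 L1 Ld LB p'.
have w0 : 0 < s.1 by case/andP: sw => [+ _]; exact: lt_le_trans.
have u0 j : 0 < tnth s.2 j by case/andP: (su j) => [+ _]; exact: lt_le_trans.
have uh0 : 0 < uh by case/andP: (su j0) => _; exact: lt_le_trans.
have q0 j : 0 < (tnth p j)^-1 by rewrite invr_gt0.
have B0 : 0 < B.
  by rewrite (lt_le_trans _ pB)// (lt_le_trans (q0 j0))// le_inv_sum.
have [bx _] := xopt; have [x0 _] := bx.
have aG j : `|tnth d j - tnth x j| <= G.
  rewrite GE (le_trans (excess_le _ _ _ _ _ j d0 p0 pB bx))//.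
  by rewrite lerD2l ler_wpM2r ?(ltW B0)//; case/andP: sw.
have G0 : 0 <= G by exact: le_trans (aG j0).
(* A step moves a price by at most [g G], hence by at most half of it, because [1 / p_j <= B]. *)
have gG j : 2 * (g * G) <= tnth p j.
  have : (tnth p j)^-1 <= B by exact: le_trans (le_inv_sum _ _ p0) pB.
  rewrite -(ler_pM2r (p0 j)) mulVf ?gt_eqF// => Bp.
  have : g * (2 * G * B) * tnth p j <= 1 * tnth p j by rewrite ler_wpM2r// ltW.
  have : g * G <= g * G * (B * tnth p j) by rewrite ler_peMr// mulr_ge0.
  by rewrite mul1r; set A := tnth p j; lra.
have eG j : `|g * (tnth d j - tnth x j)| <= g * G.
  by rewrite normrM (ger0_norm g0) ler_wpM2l.
have p'2 j : tnth p j / 2 <= tnth p' j.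
  have := gG j; have := eG j; rewrite ler_norml tnth_mktuple => /andP[_].
  by set e := g * (_ - _); lra.
have p'0 j : 0 < tnth p' j by rewrite (lt_le_trans _ (p'2 j))// divr_gt0.
split=> //.
pose l := dotp s.2 x / s.1.
have l0 : 0 < l by rewrite divr_gt0//; exact: user_opt_gt0 xopt.
have lp j : tnth s.2 j <= l * tnth p j.
  rewrite /l mulrAC ler_pdivlMr// mulrC.
  by apply: user_opt_price xopt => //; exact: ltW.
have lx j : tnth x j != 0 -> l * tnth p j = tnth s.2 j.
  move=> xj0; have := user_opt_slack j0 p s.1 s.2 x j p0 w0 u0 xopt.
  move/eqP; rewrite mulf_eq0 (negbTE xj0) orbF subr_eq0 => /eqP H.
  by rewrite /l mulrAC H mulrAC divff ?mul1r// gt_eqF.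
clearbody l.
have lq j : (tnth p j)^-1 <= l / ul.
  rewrite ler_pdivlMr// mulrC ler_pdivrMr//.
  by apply: le_trans (lp j); case/andP: (su j).
(* For [l <= L] all prices are at least [ul / L] and a step at most halves them, so [LB] gives the
   bound outright. For [l > L] the sum is shown not to increase. *)
have [lL|Ll] := leP l L.
  apply: le_trans LB; rewrite /inv_sum.
  have -> : 2 * m%:R * L / ul = \sum_(j < m) (2 * L / ul).
    by rewrite sumr_const card_ord -mulr_natl; ring.
  apply: ler_sum => j _.
  apply: (@le_trans _ _ (tnth p j / 2)^-1).
    by rewrite lef_pV2 ?posrE// divr_gt0.
  rewrite invfM invrK mulrC -mulrA ler_pM2l// (le_trans (lq j))//.
  by rewrite ler_wpM2r// invr_ge0 ltW.
have qB j : (tnth p j)^-1 <= B by exact: le_trans (le_inv_sum _ _ p0) pB.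
apply: (@le_trans _ _ (\sum_(j < m) ((tnth p j)^-1 +
    g * (tnth d j - tnth x j) * (tnth p j)^-1 ^+ 2 +
    2 * (g * G) ^+ 2 * B ^+ 3))).
  by apply: ler_sum => j _; rewrite tnth_mktuple; exact: inv_sub_le.
rewrite !big_split/= -/(inv_sum p) sumr_const card_ord -[_ *+ m]mulr_natl.
under eq_bigr do rewrite -mulrA mulrBl.
rewrite -mulr_sumr sumrB.
have dq : \sum_j tnth d j * (tnth p j)^-1 ^+ 2 <=
    (\sum_j tnth d j) / ul ^+ 2 * l ^+ 2.
  rewrite -mulrA mulr_suml ler_sum// => j _; rewrite ler_pM2l//.
  rewrite mulrC -expr_div_n lerXn2r ?nnegrE//; first exact: ltW.
  by rewrite divr_ge0// ltW.
(* Write [x_j / p_j^2] as [(p_j x_j) / p_j^3]: the money spent adds up to the budget, and every good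
   bought has [1 / p_j >= l / uh]. One power of [l] is then lowered to [L]. *)
have xq : wl * L / uh ^+ 3 * l ^+ 2 <= \sum_j tnth x j * (tnth p j)^-1 ^+ 2.
  apply: (@le_trans _ _ (s.1 * (l / uh) ^+ 3)).
    have -> : wl * L / uh ^+ 3 * l ^+ 2 = wl * ((L * l ^+ 2) / uh ^+ 3) by ring.
    rewrite expr_div_n; apply: ler_pM => //.
    - exact: ltW.
    - have L0 : 0 < L by exact: lt_le_trans L1.
      by apply/ltW/divr_gt0; rewrite ?mulr_gt0 ?exprn_gt0.
    - by case/andP: sw.
    rewrite ler_wpM2r ?invr_ge0 ?exprn_ge0 ?(ltW uh0)//.
    by rewrite [leRHS]exprS ler_wpM2r ?exprn_ge0 ?(ltW l0) ?(ltW Ll).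
  have <- : dotp p x = s.1 by apply: (user_opt_budget j0) xopt.
  rewrite mulr_suml ler_sum// => j _.
  have [->|xj0] := eqVneq (tnth x j) 0; first by rewrite mulr0 !mul0r.
  have luh : l / uh <= (tnth p j)^-1.
    rewrite ler_pdivrMr// mulrC ler_pdivlMr// lx//.
    by case/andP: (su j).
  have -> : tnth x j * (tnth p j)^-1 ^+ 2 =
      tnth p j * tnth x j * (tnth p j)^-1 ^+ 3.
    by field; rewrite gt_eqF.
  rewrite ler_wpM2l//; first by rewrite mulr_ge0// ltW.
  by rewrite lerXn2r ?nnegrE//; rewrite ?divr_ge0// ltW.
set S1 := \sum_j tnth d j * _ in dq *; set S2 := \sum_j tnth x j * _ in xq *.
have l1 : 1 <= l by rewrite (le_trans L1)// ltW.
(* The first-order change is at most [-g], since [Ld] leaves a surplus of [l^2 >= 1]; by [gG2] the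
   second-order remainders total at most [g]. *)
have : S1 - S2 <= -1.
  have := ler_wpM2r (exprn_ge0 2 (ltW l0)) Ld.
  have : 1 <= l ^+ 2 by rewrite exprn_ege1.
  lra.
move=> /(ler_wpM2l g0).
have := ler_wpM2l g0 gG2.
set Y := g * (2 * m%:R * _ * _) => H1 H2.
have -> : m%:R * (2 * (g * G) ^+ 2 * B ^+ 3) =
  g * Y by rewrite /Y; ring.
lra.
Qed.

(** Above [wh / d_j] the demand, at most [w / p_j], stays below [d_j] and the price cannot rise. Up
    to that level a step adds at most [g x_j <= g wh B <= 1], which the [+ 1] in the bound on [H]
    absorbs. *)
Lemma price_upper_step p (s : user) x (g B H G : R) j :
  (forall j, 0 < tnth p j) -> inv_sum p <= B ->
  user_box wl wh ul uh s -> budget_feasible p s.1 x ->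
  0 <= g -> g * (wh * B) <= 1 -> wh / tnth d j + 1 <= H ->
  tnth p j <= H ->
  tnth p j - g * (tnth d j - tnth x j) <= H.
Proof.
move=> p0 pB [sw _] bx g0 gX dH pH; have [x0 xw] := bx.
have [pd|pd] := leP (tnth p j) (wh / tnth d j); last first.
  suff : 0 <= g * (tnth d j - tnth x j) by lra.
  rewrite mulr_ge0// subr_ge0 -(ler_pM2l (p0 j)).
  rewrite (@le_trans _ _ wh)//; last by rewrite -ler_pdivrMr// ltW.
  rewrite (@le_trans _ _ s.1)//; last by case/andP: sw.
  apply: le_trans xw; rewrite /dotp (bigD1 j)//= lerDl sumr_ge0// => i _.
  by rewrite mulr_ge0// ltW.
have := budget_alloc_le p x s.1 B j p0 pB bx.
have B0 : 0 <= B.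
  by rewrite (le_trans _ pB)// sumr_ge0// => i _; rewrite invr_ge0 ltW.
have : s.1 * B <= wh * B by rewrite ler_wpM2r//; case/andP: sw.
move=> h1 h2; have := ler_wpM2l g0 (le_trans h2 h1).
have : 0 <= g * tnth d j by rewrite mulr_ge0// ltW.
lra.
Qed.

End Step.

(** * Trajectories of the algorithm *)

Lemma normr_ln_le {R : realType} (a : R) : 0 < a -> `|ln a| <= a + a^-1.
Proof.
move=> a0; have ai0 : 0 < a^-1 by rewrite invr_gt0.
have := ln_sublinear a0; have := ln_sublinear ai0; rewrite lnV ?posrE//.
by rewrite ler_norml => ? ?; apply/andP; split; lra.
Qed.

Section Path.
Context {R : realType} {m : nat} (j0 : 'I_m).
Context {wl wh ul uh : R} (wl0 : 0 < wl) (ul0 : 0 < ul).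
Context (d : m.-tuple R) (d0 : forall j, 0 < tnth d j).
Context (choose : nat -> m.-tuple R -> @user R m -> m.-tuple R).
Context (choose_opt : forall t p (s : @user R m),
  (exists x, is_user_opt p s.1 s.2 x) -> is_user_opt p s.1 s.2 (choose t p s)).
Implicit Types (p : m.-tuple R) (s : @user R m).

Local Notation ubox := (user_box wl wh ul uh).

Definition price_box (lo hi : R) : set (m.-tuple R) :=
  [set p | forall j, lo <= tnth p j <= hi].

Lemma choose_user_opt t p s : (forall j, 0 < tnth p j) -> ubox s ->
  is_user_opt p s.1 s.2 (choose t p s).
Proof.
move=> p0 [sw su]; apply/choose_opt/(user_opt_exists j0) => //.
  by case/andP: sw => [+ _]; exact/le_trans/ltW.
by move=> j; case/andP: (su j) => [+ _]; exact: lt_le_trans.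
Qed.

(** The index 0 is arbitrary: all optimal bundles have the same utility ([log_valueE]). *)
Definition log_value p s : R := s.1 * ln (dotp s.2 (choose 0 p s)).

Lemma log_valueE t p s : (forall j, 0 < tnth p j) -> ubox s ->
  s.1 * ln (dotp s.2 (choose t p s)) = log_value p s.
Proof.
move=> p0 bs; rewrite /log_value; congr (_ * ln _).
have [f1 o1] := choose_user_opt t p s p0 bs.
have [f2 o2] := choose_user_opt 0 p s p0 bs.
by apply/eqP; rewrite eq_le o1// o2.
Qed.

(** Lagrangian dual cost of one user, up to the constant term [- s.1]. *)
Definition dual_value p s : R := log_value p s + dotp p d.

(** A unit of money buys utility at most [uh / lo], and the whole budget spent on good [j0] yields
    at least [wl ul / hi]; [normr_ln_le] turns both into a bound on the logarithm. *)
Lemma dual_value_bound lo hi p s : 0 < lo -> 0 < hi -> price_box lo hi p ->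
  ubox s ->
  `|dual_value p s| <= wh * (uh * wh / lo + hi / (wl * ul)) +
                       hi * \sum_(j < m) tnth d j.
Proof.
move=> lo0 hi0 pb bs.
have p0 j : 0 < tnth p j by case/andP: (pb j) => [+ _]; exact: lt_le_trans.
have xopt := choose_user_opt 0 p s p0 bs; have [[x0 xw] _] := xopt.
have [/andP[sl sh] su] := bs.
have w0 : 0 < s.1 by exact: lt_le_trans sl.
have u0 j : 0 < tnth s.2 j by case/andP: (su j) => [+ _]; exact: lt_le_trans.
have a0 := user_opt_gt0 j0 p s.1 s.2 _ p0 w0 u0 xopt.
have uh0 : 0 <= uh.
  by case/andP: (su j0) => + +; move=> /(le_trans (ltW ul0))/le_trans; apply.
apply: le_trans (ler_normD _ _) _; apply: lerD.
  rewrite /log_value normrM gtr0_norm//; apply: ler_pM => //; first exact: ltW.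
  apply: le_trans (normr_ln_le _ a0) _; apply: lerD.
    rewrite ler_pdivlMr// /dotp mulr_suml.
    apply: (@le_trans _ _ (uh * dotp p (choose 0 p s))); last first.
      by rewrite ler_wpM2l// (le_trans xw).
    rewrite /dotp mulr_sumr ler_sum// => j _; rewrite -mulrA.
    case/andP: (su j) => _ uj; case/andP: (pb j) => lp _.
    apply: ler_pM => //; [exact: ltW|by rewrite mulr_ge0// ltW|].
    by rewrite mulrC ler_wpM2r.
  rewrite -[leLHS]mul1r ler_pdivrMr// mulrAC ler_pdivlMr ?mulr_gt0// mul1r.
  have := user_opt_price p s.1 s.2 _ j0 p0 (ltW w0) xopt.
  set a := dotp _ _ in a0 *; move=> h.
  apply: (@le_trans _ _ (s.1 * tnth s.2 j0)).
    by apply: ler_pM => //; [exact: ltW|exact: ltW|case/andP: (su j0)].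
  rewrite (le_trans h)// mulrC ler_wpM2r ?(ltW a0)//.
  by case/andP: (pb j0).
rewrite ger0_norm; last by rewrite sumr_ge0// => j _; rewrite mulr_ge0// ltW.
rewrite /dotp mulr_sumr ler_sum// => j _; rewrite ler_wpM2r// ?(ltW (d0 j))//.
by case/andP: (pb j).
Qed.

Context (xi : nat -> @user R m) (xib : forall t, ubox (xi t)).
Context (p1 : m.-tuple R) (g : R).

Local Notation price := (rp_price choose g d p1 xi).
Local Notation alloc := (rp_alloc choose g d p1 xi).

Lemma rp_priceS t j : tnth (price t.+1) j =
  tnth (price t) j - g * (tnth d j - tnth (alloc t) j).
Proof. by rewrite /= tnth_mktuple. Qed.

Lemma sum_alloc n j : g * (\sum_(t < n) tnth (alloc t) j - n%:R * tnth d j) =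
  tnth (price n) j - tnth p1 j.
Proof.
elim: n => [|n IH]; first by rewrite big_ord0 mul0r !subr0 mulr0 subrr.
rewrite big_ord_recr rp_priceS -natr1.
by move: IH; set S := \sum_(t < n) _; rewrite /=; lra.
Qed.

(** * Weak duality and telescoping along one path with positive prices *)

Section weak_duality.
Context (price0 : forall t j, 0 < tnth (price t) j).

Lemma alloc_opt t : is_user_opt (price t) (xi t).1 (xi t).2 (alloc t).
Proof. exact: choose_user_opt. Qed.

Lemma xi_gt0 t : 0 < (xi t).1 /\ forall j, 0 < tnth (xi t).2 j.
Proof.
have [sw su] := xib t; split=> [|j].
  by case/andP: sw => [+ _]; exact: lt_le_trans.
by case/andP: (su j) => [+ _]; exact: lt_le_trans.
Qed.

Lemma dotp_price_alloc t : dotp (price t) (alloc t) = (xi t).1.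
Proof.
have [w0 u0] := xi_gt0 t.
by apply: (user_opt_budget j0) (alloc_opt t).
Qed.

(* At any fixed price vector [p], the Lagrangian of the offline program
   bounds its optimum. *)
Lemma offline_opt_le n p : (forall j, 0 < tnth p j) ->
  (offline_opt d xi n <=
    (\sum_(t < n) (dual_value p (xi t) - (xi t).1))%:E)%E.
Proof.
move=> p0; apply: ge_ereal_sup => _ [X [X0 [Xc Xu]] <-]; rewrite lee_fin.
have dotX t (u : m.-tuple R) :
    dotp u [tuple X t j | j < m] = \sum_(j < m) tnth u j * X t j.
  by apply: eq_bigr => j _; rewrite tnth_mktuple.
have pX : \sum_(t < n) dotp p [tuple X t j | j < m] <= \sum_(t < n) dotp p d.
  under eq_bigr do rewrite dotX.
  rewrite exchange_big/= sumr_const card_ord -[_ *+ n]mulr_natl mulr_sumr.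
  apply: ler_sum => j _; rewrite -mulr_sumr mulrCA ler_wpM2l ?Xc//.
  exact: ltW.
apply: (@le_trans _ _ (\sum_(t < n) (log_value p (xi t) +
    dotp p [tuple X t j | j < m] - (xi t).1))).
  apply: ler_sum => t _; rewrite -dotX; have [w0 u0] := xi_gt0 t.
  apply: (user_opt_ln_dual j0) => //; first exact: choose_user_opt.
    by move=> j; rewrite tnth_mktuple.
  by rewrite dotX.
rewrite !big_split/= !lerD2r !lerD2l; exact: pX.
Qed.

Lemma regret_le n p : (forall j, 0 < tnth p j) ->
  (offline_opt d xi n - (online_utility choose g d p1 xi n)%:E <=
   (\sum_(t < n) (dual_value p (xi t) - dual_value (price t) (xi t)) +
    \sum_(t < n) (dotp (price t) d - (xi t).1))%:E)%E.
Proof.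
move=> p0; rewrite leeBlDr//; apply: le_trans (offline_opt_le n p p0) _.
rewrite -EFinD lee_fin /online_utility -!big_split/=; apply: ler_sum => t _.
by rewrite log_valueE// /dual_value; lra.
Qed.

(** Expand [|p^(t+1)|^2 = |p^t|^2 - 2 g p^t . (d - x_t) + g^2 |d - x_t|^2] and use
    [p^t . x_t = w_t]. The induction carries the final squared norm, which is dropped as
    nonnegative. *)
Lemma price_norm_drift n G :
  (forall t j, `|tnth d j - tnth (alloc t) j| <= G) ->
  2 * g * \sum_(t < n) (dotp (price t) d - (xi t).1) <=
  \sum_(j < m) tnth p1 j ^+ 2 + n%:R * (g ^+ 2 * (m%:R * G ^+ 2)).
Proof.
move=> dG.
suff : \sum_(j < m) tnth (price n) j ^+ 2 +
    2 * g * \sum_(t < n) (dotp (price t) d - (xi t).1) <=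
    \sum_(j < m) tnth p1 j ^+ 2 + n%:R * (g ^+ 2 * (m%:R * G ^+ 2)).
  apply: le_trans; rewrite lerDr sumr_ge0// => j _; exact: sqr_ge0.
elim: n => [|n IH]; first by rewrite big_ord0 mulr0 mul0r.
have := lerD IH (lexx (g ^+ 2 * (m%:R * G ^+ 2))).
rewrite (_ : n.+1%:R * _ = n%:R * (g ^+ 2 * (m%:R * G ^+ 2)) +
  g ^+ 2 * (m%:R * G ^+ 2)); last by rewrite -natr1 mulrDl mul1r.
rewrite addrA; apply: le_trans.
have -> : \sum_(j < m) tnth (price n.+1) j ^+ 2 =
   \sum_(j < m) tnth (price n) j ^+ 2 -
   2 * g * (dotp (price n) d - (xi n).1) +
   g ^+ 2 * \sum_(j < m) (tnth d j - tnth (alloc n) j) ^+ 2.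
  rewrite -dotp_price_alloc /dotp -sumrB !mulr_sumr -sumrB -big_split/=.
  by apply: eq_bigr => j _; rewrite tnth_mktuple -/(alloc n); ring.
have : g ^+ 2 * \sum_(j < m) (tnth d j - tnth (alloc n) j) ^+ 2 <=
    g ^+ 2 * (m%:R * G ^+ 2).
  rewrite ler_wpM2l ?sqr_ge0//.
  have -> : m%:R * G ^+ 2 = \sum_(j < m) G ^+ 2.
    by rewrite sumr_const card_ord mulr_natl.
  apply: ler_sum => j _; rewrite -real_normK ?num_real// lerXn2r ?nnegrE//.
  exact: le_trans (dG n j).
rewrite big_ord_recr/=; set S := \sum_(i < n) _; set Q := \sum_(j < m) _ ^+ 2.
by set T := \sum_(j < m) _ ^+ 2; lra.
Qed.

End weak_duality.

(** * The invariant price box and its consequences along one path *)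

Section price_bounds.
Context (B L G H : R).
Context (p10 : forall j, 0 < tnth p1 j) (p1B : inv_sum p1 <= B).
Context (p1H : forall j, tnth p1 j <= H)
  (dH : forall j, wh / tnth d j + 1 <= H).
Context (GE : G = \sum_(j < m) tnth d j + wh * B) (g0 : 0 < g)
  (gG1 : g * (2 * G * B) <= 1) (gG2 : g * (2 * m%:R * G ^+ 2 * B ^+ 3) <= 1)
  (L1 : 1 <= L) (B1 : 1 <= B).
Context (Ld : (\sum_(j < m) tnth d j) / ul ^+ 2 + 1 <= wl * L / uh ^+ 3)
  (LB : 2 * m%:R * L / ul <= B).

(** The constants do not depend on [t]: [B] controls inverse prices, [H] caps prices, [G] bounds the
    excess [|d_j - x_j|], and [L] is the threshold on the utility per unit of money in
    [inv_sum_step]. *)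
Lemma price_bounds t : [/\ forall j, 0 < tnth (price t) j,
  inv_sum (price t) <= B & forall j, tnth (price t) j <= H].
Proof.
have B0 : 0 < B by exact: lt_le_trans B1.
have wh0 : 0 < wh.
  by have [/andP[h1 h2] _] := xib 0; rewrite (lt_le_trans wl0)// (le_trans h1).
have gX : g * (wh * B) <= 1.
  apply: le_trans gG1; rewrite ler_wpM2l ?(ltW g0)// GE.
  have : 0 <= (\sum_(j < m) tnth d j) * B.
    by rewrite mulr_ge0 ?(ltW B0)// sumr_ge0// => j _; exact: ltW.
  have : wh * B <= wh * B * B by rewrite ler_peMr// mulr_ge0 ?ltW.
  have : 0 < wh * B by exact: mulr_gt0.
  by set S := \sum_j _; lra.
elim: t => [|t [p0 pB pH]]; first by split.
have xopt := choose_user_opt t (price t) (xi t) p0 (xib t).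
have [p0' pB'] := inv_sum_step wl0 ul0 d0 j0 (price t) (xi t)
  (choose t (price t) (xi t)) g B L G p0 pB (xib t) xopt GE (ltW g0) gG1 gG2
  L1 Ld LB.
split=> // j; rewrite rp_priceS.
apply: (price_upper_step d0 (price t) (xi t) _ g B) => //.
  by case: xopt.
exact: ltW.
Qed.

Lemma price_in_box t : price_box B^-1 H (price t).
Proof.
have [p0 pB pH] := price_bounds t; move=> j; rewrite pH andbT.
rewrite -[leRHS]invrK lef_pV2 ?posrE ?invr_gt0//.
  exact: le_trans (le_inv_sum _ _ p0) pB.
exact: lt_le_trans B1.
Qed.

(** By telescoping, each coordinate of the overshoot is at most [H / g]; the norm is then at most
    [sqrt m (H / g)], relaxed to [m (H / g)]. *)
Lemma violation_le n : violation choose g d p1 xi n <= m%:R * (H / g).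
Proof.
have Hg0 : 0 <= H / g.
  rewrite divr_ge0 ?(ltW g0)//; apply: le_trans (p1H j0); exact: ltW.
rewrite /violation -[leRHS](ger0_norm (mulr_ge0 (ler0n _ _) Hg0)) -sqrtr_sqr.
rewrite ler_wsqrtr//; apply: (@le_trans _ _ (\sum_(j < m) (H / g) ^+ 2)).
  apply: ler_sum => j _; rewrite lerXn2r ?nnegrE ?le_max ?lexx// ge_max Hg0/=.
  rewrite ler_pdivlMr// mulrC sum_alloc.
  have [_ _ /(_ j)] := price_bounds n; have := p10 j; lra.
rewrite sumr_const card_ord [in leRHS]exprMn -[_ *+ m]mulr_natl.
rewrite ler_wpM2r ?sqr_ge0//.
by rewrite -natrX ler_nat -mulnn leq_pmulr// (leq_trans _ (ltn_ord j0)).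
Qed.

Lemma alloc_excess_le t j : `|tnth d j - tnth (alloc t) j| <= G.
Proof.
have [p0 pB _] := price_bounds t.
have [bx _] := alloc_opt (fun t => let: And3 h _ _ := price_bounds t in h) t.
rewrite GE (le_trans (excess_le _ _ _ _ _ j d0 p0 pB bx))// lerD2l ler_wpM2r//.
  exact: le_trans B1.
by have [/andP[]] := xib t.
Qed.

(** Combines [regret_le] with [price_norm_drift] divided by [g]; the factor 2 of the latter is given
    away, its right-hand side being nonnegative. *)
Lemma regret_path_le n p : (forall j, 0 < tnth p j) ->
  (offline_opt d xi n - (online_utility choose g d p1 xi n)%:E <=
   (\sum_(t < n) (dual_value p (xi t) - dual_value (price t) (xi t)) +
    ((\sum_(j < m) tnth p1 j ^+ 2) / g + n%:R * g * (m%:R * G ^+ 2)))%:E)%E.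
Proof.
move=> p0; have price0 t : forall j, 0 < tnth (price t) j.
  by case: (price_bounds t).
apply: le_trans (regret_le price0 n p p0) _; rewrite lee_fin lerD2l.
have := price_norm_drift price0 n G alloc_excess_le.
set S := \sum_(t < n) _; set Q := \sum_(j < m) _; set V := m%:R * _ => h.
have V0 : 0 <= V by rewrite mulr_ge0 ?sqr_ge0.
have Q0 : 0 <= Q by rewrite sumr_ge0// => j _; exact: sqr_ge0.
have -> : Q / g + n%:R * g * V = (Q + n%:R * g ^+ 2 * V) / g.
  by field; rewrite gt_eqF.
rewrite ler_pdivlMr//.
have : 0 <= n%:R * g ^+ 2 * V.
  by apply: mulr_ge0 => //; apply: mulr_ge0 => //; exact: sqr_ge0.
by move: h; clearbody S Q V; lra.
Qed.

End price_bounds.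
End Path.

(** * Integration and independence *)

Lemma measurable_mem {dT} {T : measurableType dT} (A : set T) :
  measurable A -> measurable_fun setT (fun x => x \in A).
Proof.
by move=> mA; apply: (measurable_fun_bool true); rewrite setTI preimage_mem_true.
Qed.

Section Integral.
Local Open Scope ereal_scope.
Context d (T : measurableType d) (R : realType) (mu : {measure set T -> \bar R}).
Implicit Types f g : T -> \bar R.

(* No measurability is needed: the integral of a nonnegative function is a
   supremum over the simple functions below it. *)
Lemma ge0_integral_mono f g : (forall x, 0 <= f x) -> (forall x, f x <= g x) ->
  \int[mu]_x f x <= \int[mu]_x g x.
Proof.
move=> f0 fg; have g0 x : 0 <= g x by exact: le_trans (fg x).
rewrite !ge0_integralTE//; apply: le_ereal_sup => _ [h hf <-]; exists h => //.
by move=> x; exact: le_trans (fg x).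
Qed.

Lemma integral_mono f g : (forall x, f x <= g x) ->
  \int[mu]_x f x <= \int[mu]_x g x.
Proof.
move=> fg; rewrite integralE [leRHS]integralE; apply: leeB.
  apply: ge0_integral_mono => x; first exact: funepos_ge0.
  by apply: (@funepos_le _ _ setT) => //; rewrite inE.
apply: ge0_integral_mono => x; first exact: funeneg_ge0.
by apply: (@funeneg_le _ _ setT) => //; rewrite inE.
Qed.

(** Raising [g] to [+oo] on a measurable null set containing all exceptions makes the inequality
    hold everywhere and keeps the integral of [g]. Here [f] will be the regret, which contains a
    supremum over allocations. *)
Lemma ae_integral_mono f g : measurable_fun setT g ->
  {ae mu, forall x, f x <= g x} -> \int[mu]_x f x <= \int[mu]_x g x.
Proof.
move=> mg [N [mN N0 fgN]].
have mNb := measurable_mem N mN.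
pose g' x := if x \in N then +oo else g x.
have mg' : measurable_fun setT g' by apply: measurable_fun_ifT.
have -> : \int[mu]_x g x = \int[mu]_x g' x.
  apply: ae_eq_integral => //; exists N; split => // x /= h.
  by apply: contrapT => xN; apply: h => _; rewrite /g' memNset.
apply: integral_mono => x; rewrite /g'; case: ifPn => [_|/negP xN].
  exact: leey.
by apply: contrapT => h; apply: xN; rewrite inE; exact: fgN.
Qed.

End Integral.

(** * Independence of the next user from the past *)

Section Independence.
Local Open Scope ereal_scope.
Context {dO} {Omega : measurableType dO} {R : realType} {P : probability Omega R}.

(** The law of [(X, Y)] agrees on rectangles with the product of the law of [X] and [D], so they are
    equal, and Tonelli's theorem applies. *)
Lemma integral_indep {d1 d2} {T1 : measurableType d1} {T2 : measurableType d2}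
    {D : probability T2 R} (X : Omega -> T1) (Y : Omega -> T2)
    (F : T1 * T2 -> \bar R) :
  measurable_fun setT X -> measurable_fun setT Y ->
  (forall A B, measurable A -> measurable B ->
    P (X @^-1` A `&` Y @^-1` B) = P (X @^-1` A) * D B) ->
  measurable_fun setT F -> (forall z, 0 <= F z) ->
  \int[P]_o F (X o, Y o) = \int[P]_o \int[D]_y F (X o, y).
Proof.
move=> mX mY ind mF F0.
pose X' : {mfun Omega >-> T1} := mfun_Sub (mem_set mX).
pose Z' : {mfun Omega >-> (T1 * T2)%type} :=
  mfun_Sub (mem_set (measurable_fun_pair mX mY)).
transitivity (\int[distribution P Z']_z F z).
  by rewrite ge0_integral_distribution.
transitivity (\int[distribution P X' \x D]_z F z).
  apply: eq_measure_integral => A mA _; apply/esym.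
  by apply: product_measure_unique => // B C mB mC; exact: ind.
rewrite fubini_tonelli1// ge0_integral_distribution//.
  exact: measurable_fun_fubini_tonelli_F.
by move=> x; exact: integral_ge0.
Qed.

Context {dS} {S : measurableType dS} {D : probability S R}.
Context (xi : nat -> Omega -> S).
Context (hxi : iid_with_law P D xi).

(** Cylinder events of the first [n] users: closed under intersection and generating the
    sigma-algebra of the history. *)
Definition past n : set (set Omega) :=
  [set E | exists2 A : nat -> set S, (forall i, measurable (A i)) &
    E = \big[setI/setT]_(i <- iota 0 n) (xi i @^-1` A i)].

Lemma past_measurable n : past n `<=` measurable.
Proof.
have [mxi _] := hxi.
move=> _ [A mA ->]; apply: bigsetI_measurable => i _.
by rewrite -[X in measurable X]setTI; exact: mxi.
Qed.

Lemma past_xi n i : (i < n)%N ->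
  measurable_fun setT (xi i : g_sigma_algebraType (past n) -> S).
Proof.
move=> i_n _ A mA; rewrite setTI; apply: sub_sigma_algebra.
exists (fun j => if j == i then A else setT).
  by move=> j; case: ifP.
rewrite (bigD1_seq i) ?iota_uniq//=; last by rewrite mem_iota.
rewrite eqxx big1 ?setIT// => j /negbTE ->.
by rewrite preimage_setT.
Qed.

(** As functions of [E], both sides are finite measures that agree on the cylinders, hence on the
    sigma-algebra these generate. *)
Lemma past_indep n E A : <<s past n >> E -> measurable A ->
  P (E `&` xi n @^-1` A) = P E * D A.
Proof.
have [mxi [law ind]] := hxi.
move=> sE mA.
have mxA : measurable (xi n @^-1` A).
  by rewrite -[X in measurable X]setTI; exact: mxi.
have DA0 : (0 <= fine (D A))%R by exact: fine_ge0.
have DAf : (fine (D A))%:E = D A by rewrite fineK// fin_num_measure.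
suff : mrestr P mxA E = mscale (NngNum DA0) P E.
  by rewrite /mrestr /mscale/= DAf muleC.
apply: (@g_sigma_algebra_measure_unique _ R Omega (past n) _ (fun=> setT)) => //.
- exact: past_measurable.
- move=> _; exists (fun=> setT) => //.
  by rewrite big1// => i _; rewrite preimage_setT.
- by rewrite bigcup_const.
- move=> _ _ [B mB ->] [C mC ->]; exists (fun i => B i `&` C i).
    by move=> i; exact: measurableI.
  by rewrite -big_split/=; apply: eq_bigr => i _; rewrite preimage_setI.
- move=> _ [B mB ->]; rewrite -[LHS]/(P (_ `&` _)) -[RHS]/((fine (D A))%:E * _).
  rewrite DAf muleC.
  (* Coordinate [n] of the family becomes [A], so that independence of the first [n + 1] users
     factors the event. *)
  pose B' i := if i == n then A else B i.
  have mB' i : measurable (B' i) by rewrite /B'; case: ifP.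
  have iB' i : i \in iota 0 n -> B' i = B i.
    by rewrite mem_iota add0n /B' => /andP[_ i_n]; rewrite ltn_eqF.
  have := ind (iota 0 n.+1) B' (iota_uniq _ _) mB'.
  rewrite -addn1 iotaD/= add0n !big_cat/= !big_seq1.
  rewrite (_ : B' n = A); last by rewrite /B' eqxx.
  rewrite law// => H.
  have E1 : \big[setI/setT]_(i <- iota 0 n) (xi i @^-1` B' i) =
      \big[setI/setT]_(i <- iota 0 n) (xi i @^-1` B i).
    by apply: eq_big_seq => i /iB' ->.
  rewrite -E1 H; congr (_ * _).
  by rewrite ind// ?iota_uniq.
- by move=> _; rewrite -[X in X < _]/(P (_ `&` _))
    (le_lt_trans (probability_le1 _ _)) ?ltry//;
    exact: measurableI.
Qed.

End Independence.

Lemma probability_integral_cst {R : realType} {dT} {T : measurableType dT}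
  (P : probability T R) (r : \bar R) : (\int[P]_x r = r)%E.
Proof.
rewrite (integral_cst P measurableT r) [X in (_ * X)%E](_ : _ = 1%E) ?mule1//.
exact: probability_setT.
Qed.

Section NearMinimizer.
Local Open Scope ereal_scope.
Context {R : realType} {d1 d2} {T1 : measurableType d1} {T2 : measurableType d2}.
Context (D : probability T2 R) (F : T1 * T2 -> R) {M : R}.
Context (mF : measurable_fun setT F) (F0 : forall z, (0 <= F z)%R)
  (FM : forall z, (F z <= M)%R).

(** [p] is within [e] of the infimum over [K] of the expected cost [phi], attained or not; by
    independence the cost at [X] is an average of values of [phi] on [K]. As [p] is chosen before
    [X] and [Y], one price serves for all rounds. *)
Lemma near_minimizer (K : set T1) (e : R) : K !=set0 -> (0 < e)%R ->
  exists2 p, K p & forall dO (Omega : measurableType dO)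
    (P : probability Omega R) (X : Omega -> T1) (Y : Omega -> T2),
  measurable_fun setT X -> measurable_fun setT Y ->
  (forall A B, measurable A -> measurable B ->
    P (X @^-1` A `&` Y @^-1` B) = P (X @^-1` A) * D B) ->
  {ae P, forall o, K (X o)} ->
  \int[P]_o (F (p, Y o))%:E <= \int[P]_o (F (X o, Y o))%:E + e%:E.
Proof.
move=> [x Kx] e0; pose phi x := \int[D]_y (F (x, y))%:E.
have phi0 y : 0 <= phi y by apply: integral_ge0 => z _; rewrite lee_fin.
have phiM y : phi y <= M%:E.
  apply: (@le_trans _ _ (\int[D]_y M%:E)).
    by apply: ge0_integral_mono => z; rewrite lee_fin.
  by rewrite probability_integral_cst.
pose v := ereal_inf (phi @` K).
have vfin : v \is a fin_num.
  rewrite fin_numElt; apply/andP; split.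
    rewrite (@lt_le_trans _ _ 0)// ?ltNy0//.
    by apply: le_ereal_inf_tmp => _ [y _ <-].
  apply: (@le_lt_trans _ _ (phi x)); first by apply: ereal_inf_lbound; exists x.
  by rewrite (le_lt_trans (phiM x))// ltry.
have [_ [p Kp <-] pv] := lb_ereal_inf_adherent e0 vfin.
exists p => // dO Omega P X Y mX mY ind KX.
have mEF : measurable_fun setT (EFin \o F) by exact/measurable_EFinP.
have EF0 z : 0 <= (EFin \o F) z by rewrite lee_fin.
have PY B : measurable B -> P (Y @^-1` B) = D B.
  move=> mB; have := ind setT B measurableT mB.
  by rewrite preimage_setT setTI probability_setT mul1e.
have -> : \int[P]_o (F (p, Y o))%:E = phi p.
  rewrite (integral_indep (D := D) (cst p) Y (EFin \o F))//.
    exact: (probability_integral_cst P (phi p)).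
  move=> A B mA mB; rewrite preimage_cst; case: ifPn => _.
    by rewrite setTI probability_setT mul1e PY.
  by rewrite set0I measure0 mul0e.
have -> : \int[P]_o (F (X o, Y o))%:E = \int[P]_o phi (X o).
  exact: (integral_indep X Y (EFin \o F)).
apply: le_trans (ltW pv) _; rewrite leeD2r//.
have -> : ereal_inf [set phi x | x in K] = \int[P]_o cst v o.
  by rewrite probability_integral_cst.
apply: ae_integral_mono.
  apply: measurableT_comp => //.
  exact: (@measurable_fun_fubini_tonelli_F _ _ _ _ _ D _ mEF EF0).
apply: filterS KX => o KXo; apply: ereal_inf_lbound; by exists (X o).
Qed.

End NearMinimizer.

Lemma integral_sum_sub_le {R : realType} {dO} {Omega : measurableType dO}
    (P : probability Omega R) n (a b : nat -> Omega -> R) (c e M : R) :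
  (forall t, (t < n)%N -> measurable_fun setT (a t)) ->
  (forall t, (t < n)%N -> measurable_fun setT (b t)) ->
  (forall t o, 0 <= a t o <= M) -> (forall t o, 0 <= b t o <= M) ->
  (forall t, (t < n)%N ->
    (\int[P]_o (a t o)%:E <= \int[P]_o (b t o)%:E + e%:E)%E) ->
  (\int[P]_o (\sum_(t < n) (a t o - b t o) + c)%:E <= (n%:R * e + c)%:E)%E.
Proof.
move=> ma mb ha hb ab.
have intf (f : Omega -> R) : measurable_fun setT f ->
    (forall o, 0 <= f o <= M) -> P.-integrable setT (EFin \o f).
  move=> mf hf; apply: measurable_bounded_integrable => //.
    exact: le_lt_trans (probability_le1 P measurableT) (ltry _).
  exists M; split; first exact: num_real.
  move=> y My o _; have /andP[f0 fM] := hf o.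
  by rewrite /= ger0_norm// (le_trans fM)// ltW.
have -> : (\int[P]_o (\sum_(t < n) (a t o - b t o) + c)%:E =
    \int[P]_o (\sum_(t < n) ((a t o)%:E - (b t o)%:E) + c%:E))%E.
  by apply: eq_integral => o _; rewrite EFinD -sumEFin.
have intab (t : 'I_n) :
    P.-integrable setT (fun o => ((a t o)%:E - (b t o)%:E)%E).
  by apply: integrableB => //; [apply: intf => //; exact: ma|
                                apply: intf => //; exact: mb].
rewrite integralD//; last 2 first.
- exact: integrable_sum.
- by apply/finite_measure_integrable_cst.
rewrite probability_integral_cst EFinD leeD2r//.
rewrite integral_sum//.
have -> : (n%:R * e)%:E = (\sum_(t < n) e%:E)%E.
  by rewrite sumEFin sumr_const card_ord mulr_natl.
apply: lee_sum => t _; rewrite integralB_EFin//; last 2 first.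
- by apply: intf => //; exact: ma.
- by apply: intf => //; exact: mb.
rewrite leeBlDl ?ab//.
by apply: integrable_fin_num => //; apply: intf => //; exact: mb.
Qed.

(** * Expected regret and violation *)

Section Measurability.
Context {R : realType} {m : nat}.

Lemma measurable_dotp dT (T : measurableType dT) (f g : T -> m.-tuple R) :
  measurable_fun setT f -> measurable_fun setT g ->
  measurable_fun setT (fun x => dotp (f x) (g x)).
Proof.
move=> mf mg; apply: measurable_sum => j; apply: measurable_funM.
  exact: (measurableT_comp (measurable_tnth j) mf).
exact: (measurableT_comp (measurable_tnth j) mg).
Qed.

Lemma measurable_tnth_itv (lo hi : 'I_m -> R) :
  measurable [set p : m.-tuple R | forall j, lo j <= tnth p j <= hi j].
Proof.
rewrite (_ : [set p | _] =
  \big[setI/setT]_(j < m) ((fun p => tnth p j) @^-1` `[lo j, hi j])).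
  apply: bigsetI_measurable => j _; rewrite -[X in measurable X]setTI.
  exact: measurable_tnth.
rewrite -bigcap_seq; apply/seteqP; split => [p /= h j _ /=|p h j].
  by rewrite in_itv/=.
by have := h j; rewrite /= in_itv/= mem_index_enum; exact.
Qed.

Lemma measurable_price_box (lo hi : R) : measurable (@price_box R m lo hi).
Proof. exact: (measurable_tnth_itv (fun=> lo) (fun=> hi)). Qed.

Lemma measurable_user_itv (wl wh : R) (lo hi : 'I_m -> R) :
  measurable [set s : @user R m | wl <= s.1 <= wh /\
    forall j, lo j <= tnth s.2 j <= hi j].
Proof.
rewrite (_ : [set s | _] = `[wl, wh]%classic `*`
    [set p : m.-tuple R | forall j, lo j <= tnth p j <= hi j]).
  by apply: measurableX => //; exact: measurable_tnth_itv.
by apply/seteqP; split=> s [/= h1 h2]; split => //=; move: h1; rewrite in_itv.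
Qed.

Context (choose : nat -> m.-tuple R -> @user R m -> m.-tuple R).
Context (choose_meas : forall t,
  measurable_fun setT (fun z : m.-tuple R * @user R m => choose t z.1 z.2)).

(** The space [T] is left general so that it can also be [Omega] with the sigma-algebra of the past,
    where only the users before [n] are known to be measurable. *)
Lemma measurable_rp_price g d p1 {dT} {T : measurableType dT}
    (z : nat -> T -> @user R m) n :
  (forall i, (i < n)%N -> measurable_fun setT (z i)) ->
  measurable_fun setT (fun o => rp_price choose g d p1 (z ^~ o) n).
Proof.
elim: n => [|n IH] mz; first exact: measurable_cst.
have mp : measurable_fun setT (fun o => rp_price choose g d p1 (z ^~ o) n).
  by apply: IH => i ni; apply: mz; rewrite ltnS ltnW.
have mx : measurable_fun setT (fun o =>
    choose n (rp_price choose g d p1 (z ^~ o) n) (z n o)).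
  apply: (measurableT_comp (choose_meas n)
    (measurable_fun_pair mp (mz n (ltnSn n)))).
apply/measurable_fun_tnthP => j /=.
rewrite (_ : _ \o _ = fun o => tnth (rp_price choose g d p1 (z ^~ o) n) j -
  g * (tnth d j - tnth (choose n (rp_price choose g d p1 (z ^~ o) n) (z n o)) j));
  last by apply/funext => o /=; rewrite tnth_mktuple.
apply: measurable_funB; first exact: (measurableT_comp (measurable_tnth j) mp).
apply: measurable_funM => //; apply: measurable_funB => //.
exact: (measurableT_comp (measurable_tnth j) mx).
Qed.

Lemma measurable_dual_value d :
  measurable_fun setT (fun z : m.-tuple R * @user R m =>
    dual_value d choose z.1 z.2).
Proof.
apply: measurable_funD.
  apply: measurable_funM.
    exact: (measurableT_comp measurable_fst measurable_snd).
  apply: (measurableT_comp (@measurable_ln R)).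
  apply: measurable_dotp => //.
  exact: (measurableT_comp measurable_snd measurable_snd).
by apply: measurable_dotp.
Qed.

End Measurability.

(** Without goods every utility is 0, so no allocation is admissible and the supremum is over the
    empty set. *)
Lemma offline_opt_no_goods {R : realType} {m} (d : m.-tuple R) xi n :
  m = 0%N -> (0 < n)%N -> offline_opt d xi n = -oo%E.
Proof.
move=> m0 n0; rewrite /offline_opt (_ : [set X | _] = set0).
  by rewrite image_set0 ereal_sup0.
rewrite -subset0 => X [_ [_ /(_ (Ordinal n0))]].
by rewrite big1 ?ltxx// => j; have := ltn_ord j; rewrite {2}m0.
Qed.

Lemma violation_no_goods {R : realType} {m} choose g (d p1 : m.-tuple R) xi n :
  m = 0%N -> violation choose g d p1 xi n = 0.
Proof.
move=> m0; rewrite /violation big1 ?sqrtr0// => j.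
by have := ltn_ord j; rewrite {2}m0.
Qed.

Lemma ae_iid {R : realType} {dO} {Omega : measurableType dO}
    {P : probability Omega R} {dS} {S : measurableType dS} {D : probability S R}
    (xi : nat -> Omega -> S) (A : set S) :
  iid_with_law P D xi -> measurable A -> D A = 1%E ->
  {ae P, forall o, forall t, A (xi t o)}.
Proof.
move=> [mxi [law _]] mA DA; apply: ae_foralln => t.
have mxA : measurable (xi t @^-1` A).
  by rewrite -[X in measurable X]setTI; exact: mxi.
exists (~` (xi t @^-1` A)); split => //; first exact: measurableC.
transitivity (1 - P (xi t @^-1` A))%E; first exact: probability_setC.
by rewrite law// DA subee.
Qed.

Section Expectation.
Context {R : realType} {m : nat} (j0 : 'I_m).
Context (d : m.-tuple R) (d0 : forall j, 0 < tnth d j).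
Context (D : probability (@user R m) R).
Context (choose : nat -> m.-tuple R -> @user R m -> m.-tuple R).
Context (choose_opt : forall t p (s : @user R m),
  (exists x, is_user_opt p s.1 s.2 x) -> is_user_opt p s.1 s.2 (choose t p s)).
Context (choose_meas : forall t,
  measurable_fun setT (fun z : m.-tuple R * @user R m => choose t z.1 z.2)).
Context {dO : measure_display} {Omega : measurableType dO}
  {P : probability Omega R}.
Context (xi : nat -> Omega -> @user R m) (hxi : iid_with_law P D xi).
Context {wl wh ul uh : R} (wl0 : 0 < wl) (ul0 : 0 < ul).
Context {lo hi : R} (lo0 : 0 < lo) (lohi : lo <= hi).
Context (ubox_ae : {ae P, forall o, forall t, user_box wl wh ul uh (xi t o)}).
Context (p1 : m.-tuple R) (g : R).

Local Notation price o := (rp_price choose g d p1 (xi ^~ o)).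

Lemma measurable_price n : measurable_fun setT (fun o => price o n).
Proof. by apply: measurable_rp_price => // i _; case: hxi. Qed.

Lemma price_indep n A B : measurable A -> measurable B ->
  P ((fun o => price o n) @^-1` A `&` xi n @^-1` B) =
  (P ((fun o => price o n) @^-1` A) * D B)%E.
Proof.
move=> mA mB; apply: (past_indep xi hxi) => //.
have := measurable_rp_price choose choose_meas g d p1
  (T := g_sigma_algebraType (past xi n)) xi n
  (fun i => past_xi xi n i).
by move=> /(_ measurableT A mA); rewrite setTI.
Qed.

Context (price_ae : {ae P, forall o, forall t, price_box lo hi (price o t)}).

(* A near-minimizer [p] over the price box of the expected dual cost does
   nearly as well in expectation as the prices of the algorithm, since
   [price t] is independent of user [t]. *)
Lemma expected_regret_le n (c e : R) : 0 < e ->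
  {ae P, forall o, forall p, (forall j, 0 < tnth p j) ->
    (offline_opt d (xi ^~ o) n -
       (online_utility choose g d p1 (xi ^~ o) n)%:E <=
     (\sum_(t < n) (dual_value d choose p (xi t o) -
                    dual_value d choose (price o t) (xi t o)) + c)%:E)%E} ->
  (\int[P]_o (offline_opt d (xi ^~ o) n -
     (online_utility choose g d p1 (xi ^~ o) n)%:E) <= (n%:R * e + c)%:E)%E.
Proof.
move=> e0 reg.
pose K : set (m.-tuple R) := price_box lo hi.
pose U : set (@user R m) := user_box wl wh ul uh.
pose M := `|wh * (uh * wh / lo + hi / (wl * ul)) + hi * \sum_(j < m) tnth d j|.
(* Set to 0 off the boxes and shifted by [M] on them, the dual value becomes nonnegative and bounded
   everywhere, as [near_minimizer] requires. *)
pose F (z : m.-tuple R * @user R m) :=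
  if (z.1 \in K) && (z.2 \in U) then dual_value d choose z.1 z.2 + M else 0.
have FE p s : K p -> U s -> F (p, s) = dual_value d choose p s + M.
  by move=> Kp Us; rewrite /F/= !mem_set.
have M0 : 0 <= M by exact: normr_ge0.
have hi0 : 0 < hi by exact: lt_le_trans lohi.
have FM z : 0 <= F z <= M + M.
  case: z => p s; rewrite /F/=; case: ifPn => [/andP[pK sU]|_]; last first.
    by rewrite lexx/= addr_ge0.
  have := dual_value_bound j0 wl0 ul0 d d0 choose choose_opt lo hi
    p s lo0 hi0 (set_mem pK) (set_mem sU).
  move=> /le_trans /(_ (ler_norm _)); rewrite -/M ler_norml => /andP[? ?].
  by apply/andP; split; lra.
have mK : measurable K by exact: measurable_price_box.
have mU : measurable U.
  exact: (measurable_user_itv wl wh (fun=> ul) (fun=> uh)).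
have mF : measurable_fun setT F.
  apply: measurable_fun_ifT => //; last first.
    by apply: measurable_funD => //; exact: measurable_dual_value.
  apply: measurable_and.
    exact: (measurableT_comp (measurable_mem K mK) measurable_fst).
  exact: (measurableT_comp (measurable_mem U mU) measurable_snd).
have K0 : K !=set0.
  by exists [tuple lo | j < m] => j; rewrite tnth_mktuple lexx.
have [p Kp near] := near_minimizer D F mF
  (fun z => (andP (FM z)).1) (fun z => (andP (FM z)).2) K e K0 e0.
have p0 j : 0 < tnth p j by case/andP: (Kp j) => [+ _]; exact: lt_le_trans.
have [mxi _] := hxi.
pose a t o := F (p, xi t o); pose b t o := F (price o t, xi t o).
have ma t : measurable_fun setT (a t).
  apply: (measurableT_comp mF); exact: measurable_fun_pair.
have mb t : measurable_fun setT (b t).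
  apply: (measurableT_comp mF); apply: measurable_fun_pair => //.
  exact: measurable_price.
apply: (@le_trans _ _
    (\int[P]_o (\sum_(t < n) (a t o - b t o) + c)%:E)%E).
  apply: ae_integral_mono.
    apply/measurable_EFinP; apply: measurable_funD => //.
    by apply: measurable_sum => t; exact: measurable_funB.
  apply: filterS3 reg ubox_ae price_ae => o rego uo po.
  apply: le_trans (rego p p0) _; rewrite lee_fin lerD2r ler_sum// => t _.
  (* All arguments lie in the boxes here, and the two shifts by [M] cancel. *)
  rewrite /a /b (FE _ _ Kp (uo t)) (FE _ _ (po t) (uo t)).
  move: (dual_value _ _ p _) (dual_value _ _ (rp_price _ _ _ _ _ _) _) => x y.
  by lra.
apply: (integral_sum_sub_le P n a b c e (M + M)) => //.
- by move=> t o; exact: FM.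
- by move=> t o; exact: FM.
move=> t _.
apply: near => //; first exact: measurable_price.
  exact: price_indep.
by apply: filterS price_ae => o; exact.
Qed.

End Expectation.


(** * Choice of the constants and assembly of the two bounds *)

Theorem theorem3 (R : realType) (m : nat)
  (d : m.-tuple R) (hd : forall j, 0 < tnth d j)
  (D : probability (@user R m) R)
  (u_lo u_hi : m.-tuple R) (w_lo w_hi : R)
  (hulo : forall j, 0 < tnth u_lo j) (hwlo : 0 < w_lo)
  (hD_pos : forall j : 'I_m, (0 < D [set s | (0 < tnth s.2 j)%R])%E)
  (hD_supp : D [set s | w_lo <= s.1 <= w_hi /\
                        forall j, tnth u_lo j <= tnth s.2 j <= tnth u_hi j]
             = 1%E)
  (p1 : m.-tuple R) (hp1 : forall j, 0 < tnth p1 j)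
  (Dbar : R) (hDbar : 0 < Dbar)
  (choose : nat -> m.-tuple R -> @user R m -> m.-tuple R)
  (hchoose_opt : forall t p (s : @user R m),
      (exists x, is_user_opt p s.1 s.2 x) -> is_user_opt p s.1 s.2 (choose t p s))
  (hchoose_meas : forall t,
      measurable_fun setT (fun z : m.-tuple R * @user R m => choose t z.1 z.2))
  (dO : measure_display) (Omega : measurableType dO) (P : probability Omega R)
  (xi : nat -> Omega -> @user R m) (hxi : iid_with_law P D xi) :
  exists C : R, exists N : nat, forall n : nat, (N <= n)%N ->
    let gamma := Dbar / Num.sqrt n%:R in
    (\int[P]_w (offline_opt d (fun t => xi t w) n
                - (online_utility choose gamma d p1 (fun t => xi t w) n)%:E)
       <= (C * Num.sqrt n%:R)%:E)%E /\
    (\int[P]_w (violation choose gamma d p1 (fun t => xi t w) n)%:E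
       <= (C * Num.sqrt n%:R)%:E)%E.
Proof.
(* The case without goods is separate, as the path lemmas need some good [j0]. The threshold 1
   excludes [n = 0], where the empty allocation is admissible. *)
have [m0|m_gt0] := posnP m.
  exists 0, 1%N => n n0 g; rewrite mul0r; split.
    rewrite -[leRHS](probability_integral_cst P); apply: integral_mono => o.
    by rewrite offline_opt_no_goods// leNye.
  rewrite -[leRHS](probability_integral_cst P); apply: integral_mono => o.
  by rewrite violation_no_goods.
have j0 : 'I_m by exact: Ordinal m_gt0.
have d0 := hd.
(* Scalar bounds uniform in the goods; the added positive terms make [wh], [uh] and [ul] positive
   whatever the signs of [w_hi] and [u_hi]. *)
pose wh := w_lo + `|w_hi|; pose uh := 1 + \sum_(j < m) `|tnth u_hi j|.
pose ul := (1 + \sum_(j < m) (tnth u_lo j)^-1)^-1.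
have ulo0 j : 0 <= (tnth u_lo j)^-1 by rewrite invr_ge0 ltW.
have ul0 : 0 < ul by rewrite invr_gt0 ltr_pwDl// sumr_ge0.
have wh0 : 0 < wh by rewrite ltr_pwDl.
have uh0 : 0 < uh by rewrite ltr_pwDl// sumr_ge0.
have sd0 : 0 <= \sum_(j < m) tnth d j by rewrite sumr_ge0// => j _; exact: ltW.
have ulE j : ul <= tnth u_lo j.
  rewrite -[leRHS]invrK lef_pV2 ?posrE ?invr_gt0// ?ltr_pwDl ?sumr_ge0//.
  by rewrite (le_trans (le_term_sum (fun j => (tnth u_lo j)^-1) j ulo0))// lerDr.
have uhE j : tnth u_hi j <= uh.
  rewrite (le_trans (ler_norm _))//.
  rewrite (le_trans (le_term_sum (fun j => `|tnth u_hi j|) j _))// lerDr.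
  exact: ler01.
have ubox_ae : {ae P, forall o, forall t, user_box w_lo wh ul uh (xi t o)}.
  have mS : measurable [set s : @user R m | w_lo <= s.1 <= w_hi /\
      forall j, tnth u_lo j <= tnth s.2 j <= tnth u_hi j].
    exact: (measurable_user_itv w_lo w_hi (tnth u_lo) (tnth u_hi)).
  apply: filterS (ae_iid xi _ hxi mS hD_supp) => o h t.
  have [/andP[h1 h2] h3] := h t; split=> [|j].
    by rewrite h1 (le_trans h2)// (le_trans (ler_norm _))// lerDr ltW.
  by have /andP[h4 h5] := h3 j; rewrite (le_trans (ulE j) h4) (le_trans h5).
pose Ld := (\sum_(j < m) tnth d j) / ul ^+ 2 + 1.
have Ld0 : 0 <= Ld by rewrite addr_ge0// divr_ge0// exprn_ge0// ltW.
(* Solves [Ld <= w_lo L / uh^3], with 1 added for [1 <= L]. Next, [B] and [H] are sums of the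
   quantities they must dominate; none of these constants depends on [n]. *)
pose L := 1 + Ld * uh ^+ 3 / w_lo.
have L1 : 1 <= L.
  by rewrite lerDl divr_ge0 ?(ltW hwlo)// mulr_ge0// exprn_ge0// ltW.
have LdL : Ld <= w_lo * L / uh ^+ 3.
  rewrite ler_pdivlMr ?exprn_gt0//.
  rewrite /L (_ : w_lo * _ = w_lo + Ld * uh ^+ 3); first by rewrite lerDr ltW.
  by field; rewrite gt_eqF.
pose B := 1 + inv_sum p1 + 2 * m%:R * L / ul.
have p1i0 : 0 <= inv_sum p1 by rewrite sumr_ge0// => j _; rewrite invr_ge0 ltW.
have LB0 : 0 <= 2 * m%:R * L / ul.
  by rewrite divr_ge0 ?(ltW ul0)// !mulr_ge0// (le_trans ler01).
have B1 : 1 <= B by rewrite /B; lra.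
have p1B : inv_sum p1 <= B by rewrite /B; lra.
have LB : 2 * m%:R * L / ul <= B by rewrite /B; lra.
pose H := 1 + \sum_(j < m) tnth p1 j + \sum_(j < m) wh / tnth d j.
have wd0 j : 0 <= wh / tnth d j by rewrite divr_ge0 ?ltW.
have sp0 : 0 <= \sum_(j < m) tnth p1 j by rewrite sumr_ge0// => j _; exact: ltW.
have sw0 : 0 <= \sum_(j < m) wh / tnth d j by exact: sumr_ge0.
have p1H j : tnth p1 j <= H.
  have := le_term_sum (tnth p1) j (fun j => ltW (hp1 j)).
  by rewrite /H; move: sw0; lra.
have dH j : wh / tnth d j + 1 <= H.
  by have := le_term_sum (fun j => wh / tnth d j) j wd0; rewrite /H /=; lra.
pose G := \sum_(j < m) tnth d j + wh * B.
have G0 : 0 <= G by rewrite addr_ge0// mulr_ge0 ?(ltW wh0)// (le_trans ler01).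
(* Once [sqrt n >= k], the step [Dbar / sqrt n] satisfies both smallness conditions. *)
pose k := Dbar * (2 * G * B + 2 * m%:R * G ^+ 2 * B ^+ 3).
have B0 : 0 < B by exact: lt_le_trans B1.
have k10 : 0 <= 2 * G * B by rewrite !mulr_ge0// ltW.
have k20 : 0 <= 2 * m%:R * G ^+ 2 * B ^+ 3.
  by rewrite !mulr_ge0 ?exprn_ge0 ?(ltW B0).
have k0 : 0 <= k by rewrite mulr_ge0 ?addr_ge0// ltW.
pose Q := \sum_(j < m) tnth p1 j ^+ 2.
pose V := m%:R * G ^+ 2.
have V0 : 0 <= V by rewrite mulr_ge0// exprn_ge0.
have Q0 : 0 <= Q by rewrite sumr_ge0// => j _; exact: sqr_ge0.
have H0 : 0 <= H by exact: le_trans (ltW (hp1 j0)) (p1H j0).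
(* Coefficients of [sqrt n] in [n e] with [e = 1 / sqrt n], in [Q / g], in [n g V], and in the
   violation bound [m H / g]. The threshold ensures [n >= k^2] and [n > 0]. *)
exists (1 + Q / Dbar + Dbar * V + m%:R * H / Dbar), (Num.bound (k ^+ 2)).+1.
move=> n nN g.
have n0 : 0 < n%:R :> R by rewrite ltr0n (leq_trans _ nN).
have sn0 : 0 < Num.sqrt n%:R :> R by rewrite sqrtr_gt0.
have snE : Num.sqrt n%:R ^+ 2 = n%:R :> R by rewrite sqr_sqrtr// ltW.
have ksn : k <= Num.sqrt n%:R.
  rewrite -(ger0_norm k0) -sqrtr_sqr ler_wsqrtr//.
  rewrite (le_trans (ltW (archi_boundP (sqr_ge0 k))))// ler_nat.
  by rewrite ltnW.
have g0 : 0 < g by rewrite divr_gt0.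
have gk x : 0 <= x -> Dbar * x <= k -> g * x <= 1.
  move=> x0 xk; rewrite /g mulrAC ler_pdivrMr// mul1r.
  exact: le_trans ksn.
have gG1 : g * (2 * G * B) <= 1.
  by apply: gk => //; rewrite /k ler_wpM2l ?(ltW hDbar)// lerDl.
have gG2 : g * (2 * m%:R * G ^+ 2 * B ^+ 3) <= 1.
  by apply: gk => //; rewrite /k ler_wpM2l ?(ltW hDbar)// lerDr.
have QD0 : 0 <= Q / Dbar by rewrite divr_ge0// ltW.
have DV0 : 0 <= Dbar * V by rewrite mulr_ge0// ltW.
have mH0 : 0 <= m%:R * H / Dbar by rewrite divr_ge0 ?mulr_ge0// ltW.
set C := 1 + _ + _ + _.
split.
  have lo0 : 0 < B^-1 by rewrite invr_gt0.
  have lohi : B^-1 <= H.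
    apply: (@le_trans _ _ 1); first by rewrite invf_le1.
    by rewrite /H; move: sp0 sw0; lra.
  have price_ae : {ae P, forall o, forall t,
      price_box B^-1 H (rp_price choose g d p1 (xi ^~ o) t)}.
    apply: filterS ubox_ae => o uo t.
    by apply: (price_in_box j0 hwlo ul0 d d0 choose hchoose_opt
      (xi ^~ o) uo p1 g B L G H hp1 p1B p1H dH erefl g0 gG1 gG2 L1 B1 LdL LB).
  have e0 : 0 < (Num.sqrt n%:R)^-1 :> R by rewrite invr_gt0.
  apply: le_trans (expected_regret_le j0 d d0 D choose hchoose_opt hchoose_meas
    xi hxi hwlo ul0 lo0 lohi ubox_ae p1 g
    price_ae n (Q / g + n%:R * g * V) _ e0 _) _.
    apply: filterS ubox_ae => o uo p p0.
    exact: (regret_path_le j0 hwlo ul0 d d0 choose hchoose_opt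
      (xi ^~ o) uo p1 g B L G H hp1 p1B p1H dH erefl g0 gG1 gG2 L1 B1 LdL LB n p
      p0).
  rewrite lee_fin /g; set r := Num.sqrt n%:R in sn0 snE *.
  apply: (@le_trans _ _ ((1 + Q / Dbar + Dbar * V) * r)).
    rewrite -snE le_eqVlt; apply/orP; left; apply/eqP.
    by field; rewrite !gt_eqF.
  by rewrite ler_wpM2r ?(ltW sn0)// /C lerDl.
rewrite -[leRHS](probability_integral_cst P); apply: ae_integral_mono => //.
apply: filterS ubox_ae => o uo; rewrite lee_fin.
apply: le_trans (violation_le j0 hwlo ul0 d d0 choose hchoose_opt
  (xi ^~ o) uo p1 g B L G H hp1 p1B p1H dH erefl g0 gG1 gG2 L1 B1 LdL LB n) _.
apply: (@le_trans _ _ (m%:R * H / Dbar * Num.sqrt n%:R)).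
  rewrite le_eqVlt; apply/orP; left; apply/eqP.
  by rewrite /g; field; rewrite !gt_eqF.
by rewrite ler_wpM2r ?(ltW sn0)// /C lerDr addr_ge0// addr_ge0.
Qed.
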